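(* Let $K$ be any field, $R$ a $K$-algebra, and $J$ an ideal of $R$. If $J$ is locally f.d.ss and $R/J$ is locally matricial, then $R$ is locally f.d.ss.
   Context: All algebras are associative but not necessarily unital $K$-algebras; ideals are two-sided ring ideals that are also $K$-subspaces. A $K$-algebra $R$ is locally f.d.ss if every finite subset of $R$ is contained in a subalgebra of $R$ that is a finite dimensional semisimple $K$-algebra. A $K$-algebra is matricial if it is isomorphic to $\prod_{i=1}^k M_{n_i}(K)$ for positive integers $n_i$; it is locally matricial if every finite subset is contained in a matricial subalgebra. *)

(* Defs.v *)
From HB Require Import structures.
From mathcomp Require Import all_boot all_algebra.
Set Implicit Arguments. Unset Strict Implicit. Unset Printing Implicit Defensive.
Import GRing.Theory.
Local Open Scope ring_scope.

Definition nalg_axioms (K : fieldType) (V : lmodType K) (mul : V -> V -> V) :=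
  [/\ associative mul,
      left_distributive mul +%R, right_distributive mul +%R,
      (forall (a : K) x y, mul (a *: x) y = a *: mul x y) &
      (forall (a : K) x y, mul x (a *: y) = a *: mul x y)].

Definition subspace (K : fieldType) (V : lmodType K) (S : V -> Prop) :=
  [/\ S 0, (forall x y, S x -> S y -> S (x + y)) &
      (forall (a : K) x, S x -> S (a *: x))].

Definition subalgebra (K : fieldType) (V : lmodType K) (mul : V -> V -> V)
  (S : V -> Prop) :=
  subspace S /\ (forall x y, S x -> S y -> S (mul x y)).

Definition ideal_in (K : fieldType) (V : lmodType K) (mul : V -> V -> V)
  (S I : V -> Prop) :=
  [/\ (forall x, I x -> S x), subspace I &
      (forall x y, S x -> I y -> I (mul x y) /\ I (mul y x))].

Definition nilpotent_set (K : fieldType) (V : lmodType K) (mul : V -> V -> V)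
  (I : V -> Prop) :=
  exists n : nat, forall (x : V) (s : seq V), size s = n -> I x ->
    (forall i, (i < size s)%N -> I (nth 0 s i)) -> foldl mul x s = 0.

Definition fin_dim (K : fieldType) (V : lmodType K) (S : V -> Prop) :=
  exists s : seq V, forall x, S x <->
    exists c : 'I_(size s) -> K, x = \sum_(i < size s) c i *: s`_i.

(* Semisimple (finite dimensional) algebra: no nonzero nilpotent ideals,
   i.e. its (Wedderburn/Jacobson) radical is zero. *)
Definition semisimple_in (K : fieldType) (V : lmodType K) (mul : V -> V -> V)
  (S : V -> Prop) :=
  forall I, ideal_in mul S I -> nilpotent_set mul I -> forall x, I x -> x = 0.

Definition fdss (K : fieldType) (V : lmodType K) (mul : V -> V -> V)
  (S : V -> Prop) :=
  [/\ subalgebra mul S, fin_dim S & semisimple_in mul S].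

(* S is a subalgebra isomorphic to prod_{i<k} M_{n_i}(K), n_i > 0:
   image of an injective K-algebra homomorphism from that product. *)
Definition matricial (K : fieldType) (V : lmodType K) (mul : V -> V -> V)
  (S : V -> Prop) :=
  exists (k : nat) (n : 'I_k -> nat)
         (phi : (forall i : 'I_k, 'M[K]_(n i)) -> V),
    (forall i, (0 < n i)%N) /\
    [/\ (forall A B, phi (fun i => A i + B i) = phi A + phi B),
        (forall (a : K) A, phi (fun i => a *: A i) = a *: phi A),
        (forall A B, phi (fun i => A i *m B i) = mul (phi A) (phi B)),
        (forall A B, phi A = phi B -> forall i, A i = B i) &
        (forall x, S x <-> exists A, x = phi A)].

Definition locally (K : fieldType) (V : lmodType K) (P : (V -> Prop) -> Prop)
  (A : V -> Prop) :=
  forall s : seq V, (forall x, x \in s -> A x) ->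
    exists S : V -> Prop,
      [/\ (forall x, S x -> A x), (forall x, x \in s -> S x) & P S].

(* Main.v *)
(* A finite dimensional algebra without nilpotent ideals is von Neumann regular,
   so J is regular; conversely regularity excludes nilpotent ideals, and it
   passes to corners and to extensions.  A finite subset of J then generates a
   right ideal v J with v idempotent.  Applied to the multiplicative defects of
   lifts x of matrix units of R/J, this makes (1 - v) x a system of matrix units
   in R, spanning a matricial subalgebra T.  The given finite set lies in T + L
   with L a finite subset of J.  Since T is separable over K, averaging yields
   an idempotent u in J that commutes with T and is an identity on L.  If C is
   an f.d. semisimple subalgebra of J containing u, L and u T, then T + u C u is
   the subalgebra sought: u C u is a regular ideal of it with regular quotient. *)

Require Import Defs.
From HB Require Import structures.
From mathcomp Require Import all_boot all_algebra.
From Stdlib Require Import Classical FunctionalExtensionality.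
Import GRing.Theory.
Local Open Scope ring_scope.

Set Implicit Arguments. Unset Strict Implicit. Unset Printing Implicit Defensive.

(** * Linear independence and minimal subspaces *)

Section Subspaces.
Variables (K : fieldType) (V : lmodType K).
Implicit Types (P S : V -> Prop) (F : (V -> Prop) -> Prop).

Lemma subspaceN P x : subspace P -> P x -> P (- x).
Proof. by case=> _ _ PZ /(PZ (-1)); rewrite scaleN1r. Qed.

Lemma subspaceB P x y : subspace P -> P x -> P y -> P (x - y).
Proof. by move=> sP Px Py; case: (sP) => _ PD _; apply: PD => //; apply: subspaceN. Qed.

Lemma subspace_sum P (I : Type) (r : seq I) (f : I -> V) :
  subspace P -> (forall i, P (f i)) -> P (\sum_(i <- r) f i).
Proof. by case=> P0 PD _ Pf; apply: (big_ind P) => // *; apply: Pf. Qed.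

Definition free_family m (w : 'I_m -> V) :=
  forall c : 'rV[K]_m, \sum_i c 0 i *: w i = 0 -> c = 0.

(** If the family were longer than [s], its coefficient matrix would have more rows than columns,
    and a nonzero row of the left kernel would be a linear relation. *)
Lemma free_family_bound (s : seq V) m (w : 'I_m -> V) :
  (forall i, exists c : 'I_(size s) -> K, w i = \sum_(j < size s) c j *: s`_j) ->
  free_family w -> (m <= size s)%N.
Proof.
move=> /fin_all_exists [c wE] freew; rewrite leqNgt; apply/negP => ltsm.
pose A : 'M[K]_(m, size s) := \matrix_(i, j) c i j.
have /rowV0Pn [u /sub_kermxP uA0 u0] : kermx A != 0.
  rewrite -mxrank_eq0 mxrank_ker subn_eq0 -ltnNge.
  exact: leq_ltn_trans (rank_leq_col A) ltsm.
case/eqP: u0; apply: freew.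
under eq_bigr do rewrite wE scaler_sumr.
rewrite exchange_big big1 //= => j _.
under eq_bigr do rewrite scalerA.
rewrite -scaler_suml.
have -> : \sum_i u 0 i * c i j = 0; last by rewrite scale0r.
have /rowP /(_ j) := uA0; rewrite !mxE => uAj; rewrite -[RHS]uAj.
by apply: eq_bigr => i _; rewrite mxE.
Qed.

Lemma free_family_cons P m (w : 'I_m -> V) x :
  subspace P -> (forall i, P (w i)) -> ~ P x -> free_family w ->
  exists w' : 'I_m.+1 -> V,
    (forall i, w' i = x \/ exists j, w' i = w j) /\ free_family w'.
Proof.
move=> sP Pw nPx freew.
exists (fun i => if unlift 0 i is Some j then w j else x); split=> [i|c].
  by case: unlift => [j|]; [right; exists j | left].
rewrite big_ord_recl unlift_none.
under eq_bigr do rewrite liftK.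
have PZ : forall a y, P y -> P (a *: y) by case: sP.
move=> /eqP; rewrite addr_eq0 => /eqP c0x.
have c00 : c 0 0 = 0.
  apply/eqP; apply: contra_notT nPx => c00; rewrite -(scalerK c00 x) c0x.
  by apply: (PZ); apply: subspaceN => //; apply: subspace_sum=> // i; apply: PZ.
move/esym/eqP: c0x; rewrite c00 scale0r oppr_eq0 => /eqP c0.
have /freew/rowP cl : \sum_i (\row_j c 0 (lift 0 j)) 0 i *: w i = 0.
  by rewrite -[RHS]c0; apply: eq_bigr => i _; rewrite mxE.
apply/rowP=> i; rewrite mxE; case: (unliftP 0 i) => [j ->|-> //].
by have := cl j; rewrite !mxE.
Qed.

(** Induction on a strict bound for the lengths of free families in [P]. If [P'] is a strictly
    smaller member, a vector of [P] outside [P'] extends every free family of [P'], so the bound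
    drops by one. *)
Lemma subspace_dcc S F :
  fin_dim S -> (forall P, F P -> subspace P /\ forall x, P x -> S x) ->
  (exists P, F P) ->
  exists P, F P /\
    forall P', F P' -> (forall x, P' x -> P x) -> forall x, P x -> P' x.
Proof.
case=> s sE FS [P FP].
have bnd m (w : 'I_m -> V) : (forall i, P (w i)) -> free_family w -> (m < (size s).+1)%N.
  move=> Pw; rewrite ltnS; apply: free_family_bound => i.
  by apply/sE; apply: (FS P FP).2.
elim: (size s).+1 P FP bnd => [|d IHd] P FP bnd.
  suff : (0 < 0)%N by [].
  by apply: (bnd _ (fun=> 0)) => [[]|c _] //; apply/rowP; case.
apply: NNPP => nomin; apply: (nomin).
have [P' [FP' [P'P [x [Px nP'x]]]]] :
  exists P', F P' /\ (forall x, P' x -> P x) /\ exists x, P x /\ ~ P' x.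
  apply: NNPP => noP'; apply: nomin; exists P; split=> // P' FP' P'P x Px.
  by apply: NNPP => nP'x; apply: noP'; exists P'; split; last split; last exists x.
apply: (IHd P') => // m w P'w freew.
have [w' [w'E freew']] := free_family_cons (FS P' FP').1 P'w nP'x freew.
by apply: (bnd _ w') freew' => i; case: (w'E i) => [->//|[j ->]]; apply: P'P.
Qed.

End Subspaces.

(** * Right ideals, idempotents and regularity without a unit *)

Section Algebra.
Variables (K : fieldType) (V : lmodType K) (mul : V -> V -> V).
Hypothesis algV : nalg_axioms mul.
Local Notation "x ** y" := (mul x y) (at level 40, left associativity).
Implicit Types (C I J S : V -> Prop).

Lemma nmulA x y z : x ** (y ** z) = x ** y ** z.
Proof. by case: algV. Qed.

Lemma nmulDl x y z : (x + y) ** z = x ** z + y ** z.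
Proof. by case: algV. Qed.

Lemma nmulDr x y z : x ** (y + z) = x ** y + x ** z.
Proof. by case: algV. Qed.

Lemma nmulZl a x y : (a *: x) ** y = a *: (x ** y).
Proof. by case: algV. Qed.

Lemma nmulZr a x y : x ** (a *: y) = a *: (x ** y).
Proof. by case: algV. Qed.

Lemma nmul0l x : 0 ** x = 0.
Proof. by rewrite -[0 in LHS](scale0r 0) nmulZl scale0r. Qed.

Lemma nmul0r x : x ** 0 = 0.
Proof. by rewrite -[0 in LHS](scale0r 0) nmulZr scale0r. Qed.

Lemma nmulNl x y : (- x) ** y = - (x ** y).
Proof. by rewrite -scaleN1r nmulZl scaleN1r. Qed.

Lemma nmulNr x y : x ** (- y) = - (x ** y).
Proof. by rewrite -scaleN1r nmulZr scaleN1r. Qed.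

Lemma nmulBl x y z : (x - y) ** z = x ** z - y ** z.
Proof. by rewrite nmulDl nmulNl. Qed.

Lemma nmulBr x y z : x ** (y - z) = x ** y - x ** z.
Proof. by rewrite nmulDr nmulNr. Qed.

Lemma nmul_suml (T : Type) (r : seq T) (P : pred T) (f : T -> V) x :
  (\sum_(i <- r | P i) f i) ** x = \sum_(i <- r | P i) f i ** x.
Proof.
by apply: (big_morph (mul^~ x)) => [y z|]; rewrite ?nmulDl ?nmul0l.
Qed.

Lemma nmul_sumr (T : Type) (r : seq T) (P : pred T) (f : T -> V) x :
  x ** (\sum_(i <- r | P i) f i) = \sum_(i <- r | P i) x ** f i.
Proof. by apply: (big_morph (mul x)) => [y z|]; rewrite ?nmulDr ?nmul0r. Qed.

(** Formally 1 - w = (1 - g)(1 - v), and v g = 0 makes this product idempotent. *)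
Lemma idempotent_join v g (w := v + g - g ** v) :
  v ** v = v -> g ** g = g -> v ** g = 0 ->
  [/\ w ** w = w, w ** v = v, w ** g = g & v ** w = v].
Proof.
move=> vv gg vg.
have wv : w ** v = v by rewrite nmulBl nmulDl -nmulA vv addrK.
have wg : w ** g = g by rewrite nmulBl nmulDl -nmulA vg gg nmul0r add0r subr0.
split=> //; last by rewrite nmulBr nmulDr nmulA vv vg nmul0l subr0 addr0.
by rewrite {2}/w nmulBr nmulDr nmulA wv wg.
Qed.

Definition right_ideal_in C I :=
  [/\ (forall x, I x -> C x), subspace I & forall x c, I x -> C c -> I (x ** c)].

Definition regular_in S := forall x, S x -> exists2 y, S y & x ** y ** x = x.

(* A minimal right ideal I with I^2 = 0 would generate the nilpotent ideal
   I + C I; otherwise Brauer's argument produces the idempotent. *)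
Lemma right_ideal_idempotent C I z :
  fdss mul C -> right_ideal_in C I -> I z -> z != 0 ->
  exists f, [/\ I f, f ** f = f & f != 0].
Proof.
move=> [[sC CM] fdC ssC] rI Iz z0.
pose F P := [/\ right_ideal_in C P, forall x, P x -> I x & exists2 x, P x & x != 0].
have [||P [[[PC sP PM] PI [a0 Pa0 a00]] Pmin]] := @subspace_dcc _ _ C F fdC _ _.
- by move=> P [[]].
- by exists I; split=> //; exists z.
have [P0 PD PZ] := sP.
have [a [b [Pa Pb ab0]]] : exists a b, [/\ P a, P b & a ** b != 0].
  apply: NNPP => noab.
  have PP0 x y : P x -> P y -> x ** y = 0.
    move=> Px Py; apply/eqP; apply: contra_notT noab => xy0.
    by exists x, y.
  (* [G] is P + C P, encoded as an intersection of subspaces so that membership is an induction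
     principle. *)
  pose G x := forall H, subspace H -> (forall i, P i -> H i) ->
    (forall c i, C c -> P i -> H (c ** i)) -> H x.
  have GP i : P i -> G i by move=> Pi H _ HP _; apply: HP.
  have sG : subspace G.
    split=> [H [] //|x y Gx Gy H sH HP HC|c x Gx H sH HP HC]; case: (sH) => _ HD HZ.
      by apply: HD; [apply: Gx|apply: Gy].
    by apply: HZ; apply: Gx.
  have GC x : G x -> C x by move=> /(_ C); apply=> // c i Cc /PC; apply: CM.
  have GG x y : G x -> G y -> x ** y = 0.
    move=> Gx Gy.
    have PG i : P i -> i ** y = 0.
      move=> Pi; apply: (Gy (fun y => i ** y = 0)) => [|j Pj|c j Cc Pj].
      - by split=> [|u w iu iw|c u iu]; rewrite ?nmul0r ?nmulDr ?nmulZr ?iu ?iw ?addr0 ?scaler0.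
      - exact: PP0.
      - by rewrite nmulA; apply: PP0 => //; apply: PM.
    apply: (Gx (fun x => x ** y = 0)) => [|//|c i Cc Pi].
      by split=> [|u w uy wy|c u uy]; rewrite ?nmul0l ?nmulDl ?nmulZl ?uy ?wy ?addr0 ?scaler0.
    by rewrite -nmulA PG // nmul0r.
  have iG : ideal_in mul C G.
    split=> // c x Cc Gx; split.
      apply: (Gx (fun x => G (c ** x))) => [|i Pi|d i Cd Pi].
      - case: sG => G0 GD GZ.
        by split=> [|u w|e u]; rewrite ?nmul0r ?nmulDr ?nmulZr //; [apply: GD|apply: GZ].
      - by move=> H sH HP HC; apply: HC.
      - by rewrite nmulA => H sH HP HC; apply: HC => //; apply: CM.
    apply: (Gx (fun x => G (x ** c))) => [|i Pi|d i Cd Pi].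
    - case: sG => G0 GD GZ.
      by split=> [|u w|e u]; rewrite ?nmul0l ?nmulDl ?nmulZl //; [apply: GD|apply: GZ].
    - by apply: GP; apply: PM.
    - by rewrite -nmulA => H sH HP HC; apply: HC => //; apply: PM.
  case/eqP: a00; apply: (ssC G) => //; last exact: GP.
  (* In [nilpotent_set] the exponent 1 concerns products of two factors. *)
  exists 1%N => x [|y [|? ?]] //= _ Gx Gs; apply: GG => //; exact: (Gs 0%N).
(* The annihilator of [a] in [P] is a right ideal that misses [b], so minimality of [P] forces it to
   be zero. *)
have annF x : P x -> a ** x = 0 -> x = 0.
  move=> Px ax0; apply/eqP; apply: contraT => x0; case/eqP: ab0.
  have [||] := Pmin (fun y => P y /\ a ** y = 0) _ _ b Pb => //; last by move=> y [].
  split; [split|by move=> y [/PI]|by exists x].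
  - by move=> y [/PC].
  - split; [by split; last exact: nmul0r| |].
    + by move=> u w [Pu au] [Pw aw]; split; [apply: PD|rewrite nmulDr au aw addr0].
    + by move=> c u [Pu au]; split; [apply: PZ|rewrite nmulZr au scaler0].
  - by move=> y c [Py ay] Cc; split; [apply: PM|rewrite nmulA ay nmul0l].
(* By minimality a P = P, hence a f = a for some [f] in [P]. Then a (f f - f) = 0, and [annF] makes
   [f] idempotent. *)
have [f Pf af] : exists2 f, P f & a ** f = a.
  have [||f Pf af] := Pmin (fun y => exists2 x, P x & y = a ** x) _ _ a Pa; last by exists f.
    split; [split|by move=> _ [x Px ->]; apply: PI; apply: PM => //; apply: PC|by exists (a ** b) => //; exists b].
    - by move=> _ [x Px ->]; apply: CM; apply: PC.
    - split; first by exists 0; rewrite ?nmul0r.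
      + by move=> _ _ [x Px ->] [y Py ->]; exists (x + y); [apply: PD|rewrite nmulDr].
      + by move=> c _ [x Px ->]; exists (c *: x); [apply: PZ|rewrite nmulZr].
    - by move=> _ c [x Px ->] Cc; exists (x ** c); [apply: PM|rewrite nmulA].
  by move=> _ [x Px ->]; apply: PM => //; apply: PC.
exists f; split; first exact: PI.
- apply/eqP; rewrite -subr_eq0; apply/eqP/annF; last by rewrite nmulBr nmulA !af subrr.
  by apply: subspaceB => //; apply: PM => //; apply: PC.
- by apply: contraNneq ab0 => f0; rewrite -af f0 nmul0r nmul0l.
Qed.

(** Take an idempotent [v] of [I] with minimal annihilator in [I]. A nonzero annihilator would
    contain a nonzero idempotent [g], and the join of [v] and [g] would have a smaller annihilator,
    no longer containing [g]. *)
Lemma right_ideal_left_identity C I :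
  fdss mul C -> right_ideal_in C I ->
  exists v, [/\ I v, v ** v = v & forall z, I z -> v ** z = z].
Proof.
move=> fC rI; have [IC sI IM] := rI; have [I0 ID IZ] := sI.
pose ker v z := I z /\ v ** z = 0.
have rker v : I v -> right_ideal_in C (ker v).
  move=> Iv; split; [by move=> z [/IC]|split|].
  - by split; last exact: nmul0r.
  - by move=> x y [Ix vx] [Iy vy]; split; [apply: ID|rewrite nmulDr vx vy addr0].
  - by move=> a x [Ix vx]; split; [apply: IZ|rewrite nmulZr vx scaler0].
  - by move=> x c [Ix vx] Cc; split; [apply: IM|rewrite nmulA vx nmul0l].
pose F P := exists v, [/\ I v, v ** v = v & P = ker v].
have [|||P [[v [Iv vv ->]] vmin]] := @subspace_dcc _ _ C F _ _ _.
- by case: fC.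
- by move=> P [v [/rker[? ? _] _ ->]].
- by exists (ker 0), 0; rewrite nmul0l.
have ker0 z : ker v z -> z = 0.
  move=> kz; apply/eqP; apply: contraT => z0.
  have [g [[Ig vg] gg]] := right_ideal_idempotent fC (rker v Iv) kz z0.
  have [ww wv wg vw] := idempotent_join vv gg vg; set w := _ - _ in ww wv wg vw.
  have Iw : I w by apply: subspaceB => //; [apply: ID|apply: IM => //; apply: IC].
  have [||_] := vmin (ker w) _ _ g (conj Ig vg); first by exists w.
    by move=> x [Ix wx]; split=> //; rewrite -vw -nmulA wx nmul0r.
  by rewrite wg => ->; rewrite eqxx.
exists v; split=> // z Iz; apply/esym/eqP; rewrite -subr_eq0; apply/eqP/ker0.
split; last by rewrite nmulBr nmulA vv subrr.
by apply: subspaceB => //; apply: IM => //; apply: IC.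
Qed.

(** Without a unit at hand, the right ideal generated by [x] is K x + x C. Its left identity v = a x
    + x c satisfies x (a v + c v) = v v = v and v x = x. *)
Lemma fdss_regular C : fdss mul C -> regular_in C.
Proof.
move=> fC x Cx; have [[sC CM] _ _] := fC; have [C0 CD CZ] := sC.
pose I z := exists a c, C c /\ z = a *: x + x ** c.
have Ix : I x by exists 1, 0; rewrite nmul0r addr0 scale1r.
have [|v [Iv vv /(_ x Ix) vx]] := @right_ideal_left_identity C I fC.
  split=> [z [a [c [Cc ->]]]||z d [a [c [Cc ->]]] Cd].
  - by apply: CD; [apply: CZ|apply: CM].
  - split; first by exists 0, 0; rewrite nmul0r scale0r addr0.
    + move=> _ _ [a [c [Cc ->]]] [b [d [Cd ->]]]; exists (a + b), (c + d).
      by split; [apply: CD|rewrite nmulDr scalerDl addrACA].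
    + move=> b _ [a [c [Cc ->]]]; exists (b * a), (b *: c).
      by split; [apply: CZ|rewrite nmulZr scalerDr scalerA].
  - exists 0, (a *: d + c ** d); split; first by apply: CD; [apply: CZ|apply: CM].
    by rewrite scale0r add0r nmulDl nmulDr nmulZl nmulZr nmulA.
have [a [c [Cc vE]]] := Iv.
have Cv : C v by rewrite vE; apply: CD; [apply: CZ|apply: CM].
exists (a *: v + c ** v); first by apply: CD; [apply: CZ|apply: CM].
suff -> : x ** (a *: v + c ** v) = v by [].
by rewrite nmulDr nmulZr nmulA -nmulZl -nmulDl -vE.
Qed.

(** If x y x = x, then x = x (y x)^n for all n, and y x lies in the nilpotent ideal. *)
Lemma regular_semisimple S : regular_in S -> semisimple_in mul S.
Proof.
move=> regS I [IS sI IM] [n In] x Ix; have [y Sy xyx] := regS x (IS x Ix).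
rewrite -(In x (nseq n (y ** x))) ?size_nseq //.
  by elim: n {In} => //= n; rewrite nmulA xyx.
by move=> i ltin; rewrite nth_nseq ltin; apply: (IM y x Sy Ix).1.
Qed.

(* The last clause expresses that v lies in the right ideal L J. *)
Lemma regular_finite_left_identity J (L : seq V) :
  subalgebra mul J -> regular_in J -> (forall l, l \in L -> J l) ->
  exists v, [/\ J v, v ** v = v, forall l, l \in L -> v ** l = l &
    forall P : V -> Prop, subspace P -> (forall x c, P x -> J c -> P (x ** c)) ->
      (forall l, l \in L -> P l) -> P v].
Proof.
move=> [sJ JM] regJ; have [J0 JD JZ] := sJ.
elim: L => [|x L IHL] JL.
  by exists 0; split=> //; [exact: nmul0l|move=> P []].
have [l Ll|v [Jv vv vL vP]] := IHL; first by apply: JL; rewrite in_cons Ll orbT.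
have Jx : J x by apply: JL; rewrite mem_head.
(* This is the part of [x] that [v] does not fix. A quasi-inverse [w] of it gives an idempotent z w
   killed by [v] on the left, and the join of both fixes [x]. *)
pose z := x - v ** x.
have Jz : J z by apply: subspaceB => //; apply: JM.
have vz : v ** z = 0 by rewrite nmulBr nmulA vv subrr.
have [w Jw zwz] := regJ z Jz.
have gg : (z ** w) ** (z ** w) = z ** w by rewrite nmulA zwz.
have vg : v ** (z ** w) = 0 by rewrite nmulA vz nmul0l.
have [uu uv ug vu] := idempotent_join vv gg vg; set u := _ - _ in uu uv ug vu.
have Jg : J (z ** w) by apply: JM.
exists u; split=> //.
- by apply: subspaceB => //; [apply: JD|apply: JM].
- move=> l; rewrite in_cons => /predU1P [->|/vL vl]; last by rewrite -vl nmulA uv.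
  have -> : x = v ** x + z by rewrite addrC subrK.
  by rewrite nmulDr nmulA uv -{1 2}zwz nmulA ug.
- move=> P sP PM PL; have [_ PD _] := sP.
  have Pv : P v by apply: vP => // l Ll; apply: PL; rewrite in_cons Ll orbT.
  have Pz : P z by apply: subspaceB => //; [apply: PL; rewrite mem_head|apply: PM].
  apply: subspaceB => //; last by do 2!apply: (PM) => //.
  by apply: PD => //; apply: PM.
Qed.

End Algebra.

(** * Matrix units and the opposite algebra *)

Definition opposite (T : Type) (mul : T -> T -> T) x y := mul y x.

Lemma opposite_nalg (K : fieldType) (V : lmodType K) (mul : V -> V -> V) :
  nalg_axioms mul -> nalg_axioms (opposite mul).
Proof. by case=> mA mDl mDr mZl mZr; split=> ? *; rewrite /opposite. Qed.

(* [rho] sends an index to a chosen representative of its block, so [y s t] is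
   the usual matrix unit e_st of a product of matrix algebras when s and t lie
   in the same block; it is 0 otherwise. *)
Definition matrix_units (K : fieldType) (V : lmodType K) (mul : V -> V -> V)
    m (rho : 'I_m -> 'I_m) (y : 'I_m -> 'I_m -> V) :=
  (forall s t, rho s != rho t -> y s t = 0) /\
  forall s t t' r,
    mul (y s t) (y t' r) = if (rho s == rho t) && (t == t') then y s r else 0.

(** The units are transposed. The block tests of the two products disagree only when the resulting
    unit would join different blocks, and that unit is 0. *)
Lemma opposite_matrix_units (K : fieldType) (V : lmodType K) (mul : V -> V -> V)
    m (rho : 'I_m -> 'I_m) (y : 'I_m -> 'I_m -> V) :
  matrix_units mul rho y -> matrix_units (opposite mul) rho (fun s t => y t s).
Proof.
case=> y0 yM; split=> [s t|s t t' r]; first by rewrite eq_sym; apply: y0.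
rewrite /opposite yM (eq_sym t'); case: (eqVneq t t') => [<-|]; last by rewrite !andbF.
rewrite !andbT; case: (eqVneq (rho s) (rho t)) => [<-|nst]; case: eqP => // /eqP.
  by move=> nrs; rewrite y0.
by move=> /eqP rt; rewrite y0 // rt eq_sym.
Qed.

(** * Idempotents commuting with matrix units, and the span of the units *)

Section MatrixUnits.
Variables (K : fieldType) (V : lmodType K) (mul : V -> V -> V).
Hypothesis algV : nalg_axioms mul.
Local Notation "x ** y" := (mul x y) (at level 40, left associativity).
Variables (m : nat) (rho : 'I_m -> 'I_m) (y : 'I_m -> 'I_m -> V).
Hypothesis rhoK : forall s, rho (rho s) = rho s.
Hypothesis yMU : matrix_units mul rho y.
Implicit Types (A B : 'M[K]_m) (J : V -> Prop).

(** The identity of the span of the matrix units, in general not of the whole algebra. *)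
Let e := \sum_t y t t.

Lemma munits_mul1 s t : y s t ** e = y s t.
Proof.
case: yMU => y0 yM; rewrite nmul_sumr //.
case: (eqVneq (rho s) (rho t)) => [st|nst].
  under eq_bigr do rewrite yM st eqxx /= eq_sym.
  by rewrite -big_mkcond big_pred1_eq.
by rewrite y0 // big1 // => i _; rewrite nmul0l.
Qed.

Lemma munits_1mul s t : e ** y s t = y s t.
Proof.
case: yMU => y0 yM; rewrite nmul_suml //.
under eq_bigr do rewrite yM eqxx /=.
by rewrite -big_mkcond big_pred1_eq.
Qed.

(* Averaging v over the separability idempotent sum_t y_(t,rho t) (x) y_(rho t,t)
   makes it commute with the matrix units; it remains an idempotent with the
   same image because v J is stable under them. *)
Lemma commuting_left_identity J (L : seq V) :
  ideal_in mul (fun _ => True) J -> regular_in mul J ->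
  (forall l, l \in L -> J l) ->
  exists v, [/\ J v, v ** v = v, forall l, l \in L -> v ** l = l &
    forall s t, y s t ** v = v ** y s t].
Proof.
move=> [_ sJ JM] regJ JL; have [y0 yM] := yMU; have [J0 JD JZ] := sJ.
have JMl x z : J z -> J (x ** z) by move=> Jz; case: (JM x z I Jz).
have JMr x z : J z -> J (z ** x) by move=> Jz; case: (JM x z I Jz).
(* With these products added, the list is stable up to 0 under left multiplication by the units,
   which makes v J stable under them. *)
pose YL := [seq y p.1 p.2 ** l | p <- enum {: 'I_m * 'I_m}, l <- L].
have memYL s t l : l \in L -> y s t ** l \in YL.
  by move=> Ll; apply/allpairsP; exists ((s, t), l); rewrite mem_enum.
have JsA : subalgebra mul J by split=> // x z _; apply: JMl.
have [l|v [Jv vv vL vP]] := regular_finite_left_identity algV JsA regJ (L := L ++ YL).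
  by rewrite mem_cat => /orP [/JL//|/allpairsP [[p z] [_ /JL Jz ->]]]; apply: JMl.
have vLL l : l \in L -> v ** l = l by move=> Ll; apply: vL; rewrite mem_cat Ll.
have vYL s t l : l \in L -> v ** (y s t ** l) = y s t ** l.
  by move=> Ll; apply: vL; rewrite mem_cat memYL ?orbT.
have vyv s t : v ** (y s t ** v) = y s t ** v.
  apply: (vP (fun z => v ** (y s t ** z) = y s t ** z)).
  - by split=> [|z z' vz vz'|a z vz];
      rewrite ?nmul0r ?nmulDr ?nmulZr ?vz ?vz' // !nmul0r.
  - by move=> z c vz _; rewrite !nmulA // -(nmulA algV v) vz.
  - move=> l; rewrite mem_cat => /orP [Ll|/allpairsP [[p z] [_ Lz ->]] /=].
      exact: vYL.
    rewrite !(nmulA algV (y s t)) yM.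
    by case: ifP => _; rewrite ?vYL // nmul0l // nmul0r.
have vy s t z : v ** z = z -> v ** (y s t ** z) = y s t ** z.
  by move=> vz; rewrite -vz !(nmulA algV (y s t)) (nmulA algV v) vyv.
have ve z : v ** z = z -> v ** (e ** z) = e ** z.
  move=> vz; rewrite nmul_suml // nmul_sumr //.
  by apply: eq_bigr => t _; apply: vy.
have ee : e ** e = e by rewrite {1}/e nmul_suml //; apply: eq_bigr => t _; exact: munits_mul1.
(* On elements fixed by [v], the average [w1] acts as [e]. Formally [w2] is (1 - e) v (1 - e), and
   it acts there as 1 - e. *)
pose w1 := \sum_t y t (rho t) ** v ** y (rho t) t.
pose w2 := (v - v ** e) - e ** (v - v ** e).
have vve : v ** (v - v ** e) = v - v ** e by rewrite nmulBr // nmulA // vv.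
have fixw z : v ** z = z -> (w1 + w2) ** z = z.
  move=> vz; rewrite nmulDl //.
  have -> : w1 ** z = e ** z.
    rewrite !nmul_suml //; apply: eq_bigr => t _.
    by rewrite -!nmulA // vy // nmulA // yM rhoK !eqxx.
  have -> : w2 ** z = z - e ** z; last by rewrite addrC subrK.
  rewrite nmulBl // -(nmulA algV e) (nmulBl algV v) -(nmulA algV v) vz ve //.
  by rewrite nmulBr // (nmulA algV e) ee subrr subr0.
have vw : v ** (w1 + w2) = w1 + w2.
  rewrite nmulDr //; congr (_ + _).
    by rewrite nmul_sumr //; apply: eq_bigr => t _; rewrite nmulA // vyv.
  by rewrite nmulBr // ve // vve.
exists (w1 + w2); split.
- apply: (JD); first by apply: subspace_sum => // t; apply/JMr/JMl.
  by apply: subspaceB => //; [|apply: JMl]; apply: subspaceB => //; apply: JMr.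
- exact: fixw.
- by move=> l Ll; apply/fixw/vLL.
move=> a b; rewrite nmulDr // nmulDl //.
have -> : y a b ** w2 = 0 by rewrite nmulBr // nmulA // munits_mul1 subrr.
have -> : w2 ** y a b = 0.
  have ve0 : (v - v ** e) ** y a b = 0 by rewrite nmulBl // -nmulA // munits_1mul subrr.
  by rewrite nmulBl // -nmulA // ve0 nmul0r // subrr.
rewrite !addr0 nmul_sumr // nmul_suml //.
under [RHS]eq_bigr => t _ do rewrite -nmulA // yM rhoK eqxx /=.
under [LHS]eq_bigr => t _ do rewrite !nmulA // yM.
(* Within a block one term survives on each side, y_(a,rho a) v y_(rho a,b). Across blocks all terms
   vanish. *)
case: (eqVneq (rho a) (rho b)) => [ab|nab] /=.
  rewrite (bigD1 b) //= eqxx big1 => [|t /negPf ntb]; last first.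
    by rewrite eq_sym ntb !nmul0l.
  rewrite (bigD1 a) //= eqxx big1 => [|t /negPf ->]; last by rewrite nmul0r.
  by rewrite -ab.
rewrite !big1 // => t _; last by rewrite !nmul0l.
case: eqP => [->|_]; last by rewrite nmul0r.
by rewrite (y0 _ b) ?rhoK // nmul0r.
Qed.

Definition munits_span A := \sum_s \sum_t A s t *: y s t.

Lemma munits_spanD A B : munits_span (A + B) = munits_span A + munits_span B.
Proof.
rewrite -big_split; apply: eq_bigr => s _; rewrite -big_split.
by apply: eq_bigr => t _; rewrite !mxE scalerDl.
Qed.

Lemma munits_spanZ a A : munits_span (a *: A) = a *: munits_span A.
Proof.
rewrite scaler_sumr; apply: eq_bigr => s _; rewrite scaler_sumr.
by apply: eq_bigr => t _; rewrite !mxE scalerA.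
Qed.

(** Entries outside the blocks are invisible to [munits_span] but spoil its multiplicativity;
    truncating one factor restores it. *)
Definition block_part A := \matrix_(s, t) (if rho s == rho t then A s t else 0).

Lemma munits_span_block A : munits_span (block_part A) = munits_span A.
Proof.
apply: eq_bigr => s _; apply: eq_bigr => t _; rewrite mxE.
by case: eqP => // /eqP st; rewrite yMU.1 ?scaler0.
Qed.

(** The matrix product also sums over [t] outside the block of [s], where the product of units is 0;
    the hypothesis removes exactly these terms. *)
Lemma munits_spanM_gen A B :
  (forall s t r, rho s != rho t -> A s t * B t r *: y s r = 0) ->
  munits_span A ** munits_span B = munits_span (A *m B).
Proof.
move=> AB0; rewrite nmul_suml //; apply: eq_bigr => s _; rewrite nmul_suml //.
under [RHS]eq_bigr do rewrite mxE scaler_suml.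
rewrite exchange_big; apply: eq_bigr => t _ /=.
rewrite nmul_sumr // (bigD1 t) //= [X in _ + X]big1 => [|t' /negPf nt].
  rewrite addr0 nmul_sumr //; apply: eq_bigr => r _.
  rewrite nmulZl // nmulZr // yMU.2 eqxx andbT scalerA.
  by case: eqP => // /eqP /AB0 ->; rewrite scaler0.
rewrite nmul_sumr // big1 // => r _.
by rewrite nmulZl // nmulZr // yMU.2 (eq_sym t) nt andbF !scaler0.
Qed.

Lemma munits_spanM_blockl A B :
  munits_span (block_part A) ** munits_span B = munits_span (block_part A *m B).
Proof.
by apply: munits_spanM_gen => s t r /negPf st; rewrite mxE st mul0r scale0r.
Qed.

Lemma munits_spanM_blockr A B :
  munits_span A ** munits_span (block_part B) = munits_span (A *m block_part B).
Proof.
apply: munits_spanM_gen => s t r st; rewrite mxE.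
case: eqP => [tr|_]; last by rewrite mulr0 scale0r.
by rewrite yMU.1 ?scaler0 // -tr.
Qed.

(** The pseudo-inverse of the block part serves as quasi-inverse. It may fail to be block diagonal,
    but it stands between two block diagonal factors. *)
Lemma munits_span_regular A :
  exists B, munits_span A ** munits_span B ** munits_span A = munits_span A.
Proof.
exists (pinvmx (block_part A)).
rewrite -(munits_span_block A) munits_spanM_blockl munits_spanM_blockr.
by rewrite mulmxKpV.
Qed.

End MatrixUnits.

(** * From one-sided to two-sided identities *)

Section CentralizingIdempotent.
Variables (K : fieldType) (V : lmodType K) (mul : V -> V -> V).
Hypothesis algV : nalg_axioms mul.
Local Notation "x ** y" := (mul x y) (at level 40, left associativity).

(** The left identity [v] and a right identity [w], obtained in the opposite algebra, combine to [u]
    with 1 - u = (1 - w)(1 - v) formally. *)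
Lemma commuting_identity m (rho : 'I_m -> 'I_m) (y : 'I_m -> 'I_m -> V)
    (J : V -> Prop) (L : seq V) :
  (forall s, rho (rho s) = rho s) -> matrix_units mul rho y ->
  ideal_in mul (fun _ => True) J -> regular_in mul J ->
  (forall l, l \in L -> J l) ->
  exists u, [/\ J u, u ** u = u, forall l, l \in L -> u ** l = l /\ l ** u = l &
    forall s t, y s t ** u = u ** y s t].
Proof.
move=> rhoK yMU iJ regJ JL; have [_ sJ JM] := iJ; have [J0 JD JZ] := sJ.
have [v [Jv vv vL vy]] := commuting_left_identity algV rhoK yMU iJ regJ JL.
have iJop : ideal_in (opposite mul) (fun _ => True) J.
  by split=> // x z _ Jz; case: (JM x z I Jz).
have regop : regular_in (opposite mul) J.
  by move=> x /regJ [z Jz xzx]; exists z => //; rewrite /opposite nmulA.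
(* Adding [v] to the list forces v w = v, on which the idempotency of [u] rests. *)
have JvL l : l \in v :: L -> J l by rewrite in_cons => /predU1P [->|/JL].
have [w [Jw ww wL wy]] := commuting_left_identity (opposite_nalg algV) rhoK
  (opposite_matrix_units yMU) iJop regop JvL.
have vw : v ** w = v by apply: wL; rewrite mem_head.
have Lw l : l \in L -> l ** w = l by move=> Ll; apply: wL; rewrite in_cons Ll orbT.
have wv : w ** v ** w = w ** v by rewrite -nmulA // vw.
exists (v + w - w ** v); split.
- by apply: subspaceB => //; [apply: JD|case: (JM w v I Jv)].
- rewrite nmulBr // nmulDr // !(nmulA algV _ w v).
  have -> : (v + w - w ** v) ** w = v + w - w ** v.
    by rewrite nmulBl // nmulDl // vw wv [w ** w]ww.
  have -> : (v + w - w ** v) ** v = v.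
    by rewrite nmulBl // nmulDl // -(nmulA algV w) vv addrK.
  by rewrite addrAC subrr add0r.
- move=> l Ll; split; first by rewrite nmulBl // nmulDl // -(nmulA algV w) vL // addrK.
  by rewrite nmulBr // nmulDr // (nmulA algV l) Lw // addrAC subrr add0r.
- move=> s t; have yw : y s t ** w = w ** y s t by have := wy t s.
  rewrite (nmulBr algV) (nmulDr algV) (nmulBl algV) (nmulDl algV) vy yw.
  rewrite (nmulA algV (y s t)) yw.
  by rewrite -!(nmulA algV w) vy.
Qed.

End CentralizingIdempotent.

(** * Spanning families and the matrix units of a matricial algebra *)

Lemma fin_dim_finType (K : fieldType) (V : lmodType K) (S : V -> Prop)
    (I : finType) (f : I -> V) :
  (forall x, S x <-> exists c : I -> K, x = \sum_i c i *: f i) -> fin_dim S.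
Proof.
move=> SE; exists (codom f).
pose h (i : I) : 'I_(size (codom f)) := cast_ord (esym (size_codom f)) (enum_rank i).
pose g (j : 'I_(size (codom f))) : I := enum_val (cast_ord (size_codom f) j).
have gh i : g (h i) = i by rewrite /g /h cast_ordKV enum_rankK.
have hg j : h (g j) = j by rewrite /g /h enum_valK cast_ordK.
have nthh i : (codom f)`_(h i) = f i by rewrite (nth_codom 0 f (enum_rank i)) enum_rankK.
have sumE (c : 'I_(size (codom f)) -> K) :
    \sum_(j < size (codom f)) c j *: (codom f)`_j = \sum_i c (h i) *: f i.
  rewrite (reindex h) /=; last by exists g => ? _.
  by apply: eq_bigr => i _; rewrite nthh.
move=> x; rewrite SE; split=> [[c ->]|[c ->]]; last by exists (c \o h); rewrite sumE.
by exists (c \o g); rewrite sumE; apply: eq_bigr => i _ /=; rewrite gh.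
Qed.

Lemma matricial_matrix_units (K : fieldType) (V : lmodType K) (mul : V -> V -> V)
    (S : V -> Prop) :
  matricial mul S ->
  exists m (rho : 'I_m -> 'I_m) (y : 'I_m -> 'I_m -> V),
    [/\ forall s, rho (rho s) = rho s, matrix_units mul rho y &
        forall x, S x -> exists A, x = munits_span y A].
Proof.
case=> k [n [phi [n_gt0 [phiD phiZ phiM _ SE]]]].
(* The row indices of all blocks are put into one type, the tag being the block. Row 0 represents
   its block and exists because [n i] is positive. *)
pose T : finType := {i : 'I_k & 'I_(n i)}.
pose tg i (a : 'I_(n i)) : T := Tagged (fun i => 'I_(n i)) a.
pose E (s t : T) i : 'M[K]_(n i) := \matrix_(a, b) ((tg i a == s) && (tg i b == t))%:R.
pose rhoT (s : T) : T := tg (tag s) (Ordinal (n_gt0 (tag s))).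
pose rho (s : 'I_#|T|) : 'I_#|T| := enum_rank (rhoT (enum_val s)).
have rhoE s t : (rho s == rho t) = (tag (enum_val s) == tag (enum_val t)).
  rewrite (inj_eq enum_rank_inj); apply/eqP/eqP => [/(congr1 tag) //|].
  by rewrite /rhoT => ->.
(* The arguments of [phi] are dependent families, so pointwise equality must be turned into equality
   by functional extensionality. *)
have ext (A B : forall i, 'M[K]_(n i)) : (forall i a b, A i a b = B i a b) -> A = B.
  by move=> AB; apply: functional_extensionality_dep => i; apply/matrixP => a b.
have phi0 : phi (fun=> 0) = 0.
  rewrite -[RHS](scale0r (phi (fun=> 0))) -phiZ; congr phi.
  by apply: ext => i a b; rewrite scaler0.
have phi_sum (I : Type) (r : seq I) (f : I -> forall i, 'M[K]_(n i)) :
    phi (fun i => \sum_(j <- r) f j i) = \sum_(j <- r) phi (f j).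
  elim: r => [|j r IHr].
    by rewrite big_nil -[RHS]phi0; congr phi; apply: ext => i a b; rewrite big_nil.
  by rewrite big_cons -IHr -phiD; congr phi; apply: ext => i a b; rewrite big_cons.
exists #|T|, rho, (fun s t => phi (E (enum_val s) (enum_val t))); split.
- by move=> s; rewrite /rho enum_rankK.
- split=> [s t|s t t' r]; rewrite rhoE.
    move=> nst; rewrite -[RHS]phi0; congr phi; apply: ext => i a b; rewrite !mxE.
    case: eqP => //= ias; case: eqP => //= ibt; case/eqP: nst.
    by rewrite -ias -ibt.
  rewrite -phiM -[in RHS]phi0 -(fun_if phi); congr phi.
  rewrite -(inj_eq enum_val_inj).
  move: (enum_val s) (enum_val t) (enum_val t') (enum_val r) => {s t t' r} s t t' r.
  apply: ext => i a b; rewrite mxE.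
  under eq_bigr do rewrite !mxE -natrM mulnb.
  case: ifP => [/andP [/eqP st /eqP <-]|nst]; rewrite mxE.
    case: (eqVneq (tg i a) s) => [ias|]; last by rewrite big1.
    have ti : tag t = i by rewrite -st -ias.
    case: t st ti => /= j c _ ji; case: i / ji a b ias => a b ias.
    rewrite (bigD1 c) //= eqxx big1 ?addr0 // => c' nc'.
    suff -> : (tg j c' == Tagged (fun i => 'I_(n i)) c) = false by [].
    by rewrite eq_Tagged /=; apply: negbTE.
  rewrite big1 // => c _; case: eqP => //= ias; case: eqP => //= ict.
  case: eqP => //= ict'; case/negP: nst.
  by rewrite -ias -ict -ict' !eqxx.
- move=> _ /SE [A ->].
  (* When the blocks of [s] and [t] differ, [tagged_as] returns a default index; this is harmless
     because [E s t] is then 0. *)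
  pose cf (s t : T) := A (tag s) (tagged s) (tagged_as s t).
  exists (\matrix_(s, t) cf (enum_val s) (enum_val t)).
  under [RHS]eq_bigr => s _ do
    (under eq_bigr => t _ do rewrite -phiZ; rewrite -phi_sum).
  rewrite -phi_sum; congr phi; apply: ext => i a b; rewrite summxE.
  rewrite (bigD1 (enum_rank (tg i a))) //= [X in _ + X]big1 ?addr0 => [|s ns].
    rewrite summxE (bigD1 (enum_rank (tg i b))) //= [X in _ + X]big1 ?addr0 => [|t nt].
      by rewrite !mxE !enum_rankK !eqxx mulr1 /cf tagged_asE.
    rewrite !mxE enum_rankK; case: eqP => /= [|_]; last by rewrite mulr0.
    by case: eqP => [bt|]; rewrite ?mulr0 //= bt enum_valK eqxx in nt *.
  rewrite summxE big1 // => t _; rewrite !mxE; case: eqP => /= [as_|]; last by rewrite mulr0.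
  by rewrite as_ enum_valK eqxx in ns.
Qed.

(** * Lifting matrix units and extending semisimple subalgebras *)

Section Extension.
Variables (K : fieldType) (V : lmodType K) (mul : V -> V -> V).
Hypothesis algV : nalg_axioms mul.
Local Notation "x ** y" := (mul x y) (at level 40, left associativity).

(* With v a left identity of the right ideal generated by the multiplicative
   defects of arbitrary lifts x, the elements (1 - v) x multiply exactly. *)
Lemma lift_matrix_units (J : V -> Prop) (Q : lmodType K) (mulQ : Q -> Q -> Q)
    (pi : V -> Q) m (rho : 'I_m -> 'I_m) (z : 'I_m -> 'I_m -> Q) :
  ideal_in mul (fun _ => True) J -> regular_in mul J ->
  (forall x y, pi (x + y) = pi x + pi y) ->
  (forall (a : K) x, pi (a *: x) = a *: pi x) ->
  (forall x y, pi (mul x y) = mulQ (pi x) (pi y)) ->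
  (forall q, exists x, pi x = q) ->
  (forall x, pi x = 0 <-> J x) ->
  matrix_units mulQ rho z ->
  exists y, matrix_units mul rho y /\ forall s t, pi (y s t) = z s t.
Proof.
move=> [_ sJ JM] regJ piD piZ piM pi_surj piJ [z0 zM]; have [J0 JD JZ] := sJ.
have JMl x w : J w -> J (x ** w) by move=> Jw; case: (JM x w I Jw).
have JMr x w : J w -> J (w ** x) by move=> Jw; case: (JM x w I Jw).
have piN x : pi (- x) = - pi x by rewrite -scaleN1r piZ scaleN1r.
have pi0 : pi 0 = 0 by rewrite -(scale0r 0) piZ scale0r.
have [x xE] : exists x : 'I_m * 'I_m -> V, forall p, pi (x p) = z p.1 p.2 /\
    (rho p.1 != rho p.2 -> x p = 0).
  apply: (@fin_all_exists _ _ (fun p w => pi w = z p.1 p.2 /\ (rho p.1 != rho p.2 -> w = 0))).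
  move=> [s t] /=; case: (eqVneq (rho s) (rho t)) => [_|nst].
    by have [w <-] := pi_surj (z s t); exists w.
  by exists 0; rewrite pi0 z0.
(* [c] is the product that the lifts ought to have, and [d] is the defect. *)
pose c (p q : 'I_m * 'I_m) :=
  if (rho p.1 == rho p.2) && (p.2 == q.1) then x (p.1, q.2) else 0.
pose d (r : ('I_m * 'I_m) * ('I_m * 'I_m)) := x r.1 ** x r.2 - c r.1 r.2.
have xx p q : x p ** x q = d (p, q) + c p q by rewrite subrK.
have Jd r : J (d r).
  apply/piJ; rewrite piD piN piM !(xE _).1 zM /c.
  by case: ifP => _; rewrite ?(xE _).1 ?pi0 subrr.
have JsA : subalgebra mul J by split=> // u w _; apply: JMl.
(* Left multiples of defects are included so that v J is stable under the lifts; a further lift on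
   the left is absorbed by x x' = d + c. *)
pose xd (r : ('I_m * 'I_m) * (('I_m * 'I_m) * ('I_m * 'I_m))) := x r.1 ** d r.2.
have [l|v [Jv vv vL vP]] := regular_finite_left_identity algV JsA regJ (L := codom d ++ codom xd).
  by rewrite mem_cat => /orP [] /codomP [r ->]; [apply: Jd|apply/JMl/Jd].
have vd r : v ** d r = d r by apply: vL; rewrite mem_cat codom_f.
have vxd p r : v ** (x p ** d r) = x p ** d r.
  by apply: (vL (xd (p, r))); rewrite mem_cat codom_f orbT.
have vxv p : v ** (x p ** v) = x p ** v.
  apply: (vP (fun w => v ** (x p ** w) = x p ** w)).
  - by split=> [|w w' vw vw'|a w vw];
      rewrite ?(nmul0r algV) ?(nmulDr algV) ?(nmulZr algV) ?vw ?vw'.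
  - by move=> w w' vw _; rewrite (nmulA algV (x p)) (nmulA algV v) vw.
  - move=> l; rewrite mem_cat => /orP [] /codomP [r ->]; first exact: vxd.
    rewrite /xd (nmulA algV (x p)) xx (nmulDl algV) (nmulDr algV) (nmulA algV v) vd /c.
    by case: ifP => _; rewrite ?vxd // (nmul0l algV) (nmul0r algV).
exists (fun s t => x (s, t) - v ** x (s, t)); split; last first.
  move=> s t; rewrite piD (xE _).1 piN (_ : pi (_ ** _) = 0) ?subr0 //.
  by apply/piJ/JMr.
split=> [s t nst|s t t' r]; first by rewrite (xE (s, t)).2 // nmul0r // subrr.
(* Since (1 - v) x v = 0, two corrected lifts multiply to (1 - v) x x' = (1 - v)(d + c) = (1 - v)
   c. *)
have yv : (x (s, t) - v ** x (s, t)) ** v = 0 by rewrite (nmulBl algV) -(nmulA algV v) vxv subrr.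
rewrite (nmulBr algV) (nmulA algV _ v) yv (nmul0l algV) subr0.
rewrite (nmulBl algV) -(nmulA algV v) xx (nmulDr algV) vd opprD addrACA subrr add0r /c /=.
by case: ifP => // _; rewrite (nmul0r algV) subrr.
Qed.

(** Formally the quasi-inverse is a + (1 - a x) w (1 - x a), and multiplying by [x] on both sides
    gives x a x + z w z = x. *)
Lemma regular_mod_regular x a w (z := x - x ** a ** x) (q := w - w ** x ** a) :
  z ** w ** z = z -> x ** (a + (q - a ** x ** q)) ** x = x.
Proof.
move=> zwz; have qx : q ** x = w ** z.
  by rewrite (nmulBl algV) (nmulBr algV) !(nmulA algV).
have xq : x ** (q - a ** x ** q) = z ** q.
  by rewrite (nmulBr algV) (nmulBl algV) !(nmulA algV).
rewrite (nmulDr algV) (nmulDl algV) xq -(nmulA algV z) qx (nmulA algV z) zwz.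
by rewrite addrC subrK.
Qed.

(** [B] is the corner u C u. It is an ideal of the sum because [u] commutes with the units and
    multiplies them into [C]. *)
Lemma fdss_extension (C : V -> Prop) m (rho : 'I_m -> 'I_m)
    (y : 'I_m -> 'I_m -> V) u
    (B := fun b => [/\ C b, u ** b = b & b ** u = b]) :
  matrix_units mul rho y -> fdss mul C -> C u -> u ** u = u ->
  (forall s t, C (u ** y s t)) -> (forall s t, y s t ** u = u ** y s t) ->
  fdss mul (fun x => exists A b, B b /\ x = munits_span y A + b).
Proof.
move=> yMU fC Cu uu Cuy uy; have [[sC CM] fdC _] := fC; have [C0 CD CZ] := sC.
set S := fun x => _.
have uspan A : munits_span y A ** u = u ** munits_span y A.
  rewrite (nmul_suml algV) (nmul_sumr algV); apply: eq_bigr => s _.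
  rewrite (nmul_suml algV) (nmul_sumr algV); apply: eq_bigr => t _.
  by rewrite (nmulZl algV) (nmulZr algV) uy.
have Cuspan A : C (u ** munits_span y A).
  rewrite (nmul_sumr algV); apply: subspace_sum => // s.
  rewrite (nmul_sumr algV); apply: subspace_sum => // t.
  by rewrite (nmulZr algV); apply: CZ.
have sB : subspace B.
  split=> [|b b' [Cb ub bu] [Cb' ub' bu']|a b [Cb ub bu]]; split.
  - by [].
  - exact: nmul0r.
  - exact: nmul0l.
  - exact: CD.
  - by rewrite (nmulDr algV) ub ub'.
  - by rewrite (nmulDl algV) bu bu'.
  - exact: CZ.
  - by rewrite (nmulZr algV) ub.
  - by rewrite (nmulZl algV) bu.
have [B0 BD BZ] := sB.
have BM b b' : B b -> B b' -> B (b ** b').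
  move=> [Cb ub bu] [Cb' ub' bu']; split; first exact: CM.
    by rewrite (nmulA algV) ub.
  by rewrite -(nmulA algV) bu'.
have spanB A b : B b -> B (munits_span y A ** b).
  move=> [Cb ub bu]; split; last by rewrite -(nmulA algV) bu.
    by rewrite -ub (nmulA algV) uspan; apply: CM.
  by rewrite (nmulA algV) -uspan -(nmulA algV) ub.
have Bspan A b : B b -> B (b ** munits_span y A).
  move=> [Cb ub bu]; split; last by rewrite -(nmulA algV) uspan (nmulA algV) bu.
    by rewrite -bu -(nmulA algV); apply: CM.
  by rewrite (nmulA algV) ub.
have SB x b : S x -> B b -> B (x ** b).
  by move=> [A [b' [Bb' ->]]] Bb; rewrite (nmulDl algV); apply: BD; [apply: spanB|apply: BM].
have BS x b : S x -> B b -> B (b ** x).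
  by move=> [A [b' [Bb' ->]]] Bb; rewrite (nmulDr algV); apply: BD; [apply: Bspan|apply: BM].
have Sspan A : S (munits_span y A) by exists A, 0; rewrite addr0.
have spanM A A' : munits_span y A ** munits_span y A' = munits_span y (block_part rho A *m A').
  by rewrite -(munits_spanM_blockl algV yMU) (munits_span_block yMU).
split.
- split; first split.
  + exists 0, 0; split=> //; have := munits_spanZ y 0 0.
    by rewrite !scale0r => ->; rewrite addr0.
  + move=> _ _ [A [b [Bb ->]]] [A' [b' [Bb' ->]]]; exists (A + A'), (b + b').
    by split; [apply: BD|rewrite munits_spanD addrACA].
  + move=> a _ [A [b [Bb ->]]]; exists (a *: A), (a *: b).
    by split; [apply: BZ|rewrite munits_spanZ scalerDr].
  + move=> _ x [A [b [Bb ->]]] Sx; have [A' [b' [Bb' xE]]] := Sx.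
    exists (block_part rho A *m A'), (munits_span y A ** b' + b ** x).
    split; first by apply: BD; [apply: spanB|apply: BS].
    by rewrite (nmulDl algV) {1}xE (nmulDr algV) spanM addrA.
- have [sc CE] := fdC.
  pose f (i : ('I_m * 'I_m) + 'I_(size sc)) :=
    match i with inl p => y p.1 p.2 | inr j => u ** sc`_j ** u end.
  apply: (@fin_dim_finType _ _ _ _ f) => x.
  split=> [[A [b [[/CE [c bE] ub bu] ->]]]|[c ->]].
    exists (fun i => match i with inl p => A p.1 p.2 | inr j => c j end).
    rewrite /munits_span big_sumType /= pair_bigA; congr (_ + _).
    rewrite -ub -bu (nmulA algV) {1}bE (nmul_sumr algV) (nmul_suml algV).
    by apply: eq_bigr => j _; rewrite (nmulZr algV) (nmulZl algV).
  exists (\matrix_(s, t) c (inl (s, t))), (\sum_j c (inr j) *: (u ** sc`_j ** u)).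
  rewrite big_sumType /=; split; last first.
    congr (_ + _); rewrite /munits_span pair_bigA.
    by apply: eq_bigr => -[s t] _; rewrite mxE.
  apply: subspace_sum => // j; apply: BZ.
  have Cj : C sc`_j.
    apply/CE; exists (fun i => (i == j)%:R).
    rewrite (bigD1 j) //= eqxx scale1r big1 ?addr0 // => i /negPf ->.
    by rewrite scale0r.
  split; first by apply: (CM) => //; apply: CM.
    by rewrite !(nmulA algV) uu.
  by rewrite -!(nmulA algV) uu.
- apply: (regular_semisimple algV) => x Sx; have [A [b [Bb xE]]] := Sx.
  have [A' AA'A] := munits_span_regular algV yMU A.
  set t := munits_span y A in AA'A xE; set a := munits_span y A' in AA'A.
  (* Modulo [B] the element [x] equals [t], for which [a] is a quasi-inverse. *)
  have Bz : B (x - x ** a ** x).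
    have -> : x - x ** a ** x = b - (t ** a ** b + b ** a ** x).
      have -> : x ** a ** x = t + (t ** a ** b + b ** a ** x).
        by rewrite {1}xE !(nmulDl algV) {1}xE (nmulDr algV) AA'A addrA.
      by rewrite {1}xE opprD addrACA subrr add0r.
    apply: subspaceB => //; apply: BD; last by apply: (BS) => //; apply: BS => //; apply: Sspan.
    by rewrite -(nmulA algV); do 2!apply: (spanB).
  have [Cz uz zu] := Bz; set z := x - _ in Bz Cz uz zu.
  have [w Cw zwz] := fdss_regular algV fC Cz.
  (* As z = u z u, the quasi-inverse [w] may be compressed into the corner. *)
  have Bw : B (u ** w ** u).
    split; first by apply: (CM) => //; apply: CM.
      by rewrite !(nmulA algV) uu.
    by rewrite -!(nmulA algV) uu.
  have zwz' : z ** (u ** w ** u) ** z = z.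
    by rewrite !(nmulA algV) zu -(nmulA algV _ u) uz.
  have Sa : S a by apply: Sspan.
  pose q := u ** w ** u - u ** w ** u ** x ** a.
  exists (a + (q - a ** x ** q)); last exact: regular_mod_regular zwz'.
  exists A', (q - a ** x ** q); split=> //.
  have Bq : B q by apply: subspaceB => //; apply: (BS) => //; apply: BS.
  apply: subspaceB => //; rewrite -(nmulA algV).
  by apply: (SB) => //; apply: SB.
Qed.

End Extension.

(* R = (V, mul); J ideal of R; R/J is presented as (Q, mulQ) together with
   a surjective K-algebra homomorphism pi : R -> Q with kernel exactly J. *)
Theorem theorem4p10 (K : fieldType) (V : lmodType K) (mul : V -> V -> V)
  (J : V -> Prop) (Q : lmodType K) (mulQ : Q -> Q -> Q) (pi : V -> Q) :
  nalg_axioms mul ->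
  ideal_in mul (fun _ => True) J ->
  nalg_axioms mulQ ->
  (forall x y, pi (x + y) = pi x + pi y) ->
  (forall (a : K) x, pi (a *: x) = a *: pi x) ->
  (forall x y, pi (mul x y) = mulQ (pi x) (pi y)) ->
  (forall q, exists x, pi x = q) ->
  (forall x, pi x = 0 <-> J x) ->
  locally (fdss mul) J ->
  locally (matricial mulQ) (fun _ => True) ->
  locally (fdss mul) (fun _ => True).
Proof.
move=> algV iJ _ piD piZ piM pi_surj piJ locJ locQ F _.
have [_ sJ JM] := iJ; have [J0 JD JZ] := sJ.
have regJ : regular_in mul J.
  move=> x Jx; have [w|C [CJ Cx fC]] := locJ [:: x]; first by rewrite inE => /eqP ->.
  by have [w /CJ Jw xwx] := fdss_regular algV fC (Cx x (mem_head _ _)); exists w.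
have [//|S [_ SF matS]] := locQ [seq pi x | x <- F].
have [m [rho [z [rhoK zMU zspan]]]] := matricial_matrix_units matS.
have [y [yMU piy]] :=
  lift_matrix_units algV iJ regJ piD piZ piM pi_surj piJ zMU.
have pi0 : pi 0 = 0 by rewrite -(scale0r 0) piZ scale0r.
have pi_sum (r : seq 'I_m) (f : 'I_m -> V) : pi (\sum_(i <- r) f i) = \sum_(i <- r) pi (f i).
  by apply: (big_morph pi).
have pi_span A : pi (munits_span y A) = munits_span z A.
  rewrite pi_sum; apply: eq_bigr => s _; rewrite pi_sum; apply: eq_bigr => t _.
  by rewrite piZ piy.
(* [L] collects, for each [x] in [F], an error term in [J]: the coefficients [A] are read off from
   [pi x]. *)
have [L [JL FL]] : exists L : seq V, (forall l, l \in L -> J l) /\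
    forall x, x \in F -> exists A, x - munits_span y A \in L.
  have : forall x, x \in F -> S (pi x) by move=> x Fx; apply/SF/map_f.
  elim: (F) => [|x F' IHF] SF'; first by exists [::].
  have [x' F'x'|L [JL FL]] := IHF; first by apply: SF'; rewrite in_cons F'x' orbT.
  have [A xA] := zspan _ (SF' x (mem_head _ _)).
  exists ((x - munits_span y A) :: L); split=> [l|x'].
    rewrite in_cons => /predU1P [->|/JL //]; apply/piJ.
    by rewrite piD -scaleN1r piZ scaleN1r pi_span xA subrr.
  rewrite in_cons => /predU1P [->|/FL [A' LA']]; first by exists A; rewrite mem_head.
  by exists A'; rewrite in_cons LA' orbT.
have [u [Ju uu uL uy]] := commuting_identity algV rhoK yMU iJ regJ JL.
have [l|C [CJ CX fC]] :=
  locJ (u :: L ++ codom (fun p : 'I_m * 'I_m => mul u (y p.1 p.2))).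
  rewrite in_cons mem_cat => /predU1P [-> //|/orP [/JL //|/codomP [p ->]]].
  by case: (JM (y p.1 p.2) u I Ju).
have Cuy s t : C (mul u (y s t)).
  apply: CX; rewrite in_cons mem_cat.
  by rewrite (codom_f (fun p => mul u (y p.1 p.2)) (s, t)) !orbT.
have Cu : C u by apply: CX; rewrite mem_head.
have := fdss_extension algV yMU fC Cu uu Cuy uy.
set S' := fun x => _; exists S'; split=> // x /FL [A LA].
(* The error term is fixed by [u] on both sides and lies in [C], hence in the corner. *)
have [ul lu] := uL _ LA; exists A, (x - munits_span y A); split; last by rewrite addrC subrK.
by split=> //; apply: CX; rewrite in_cons mem_cat LA orbT.
Qed.
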